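(* For every integer $n\ge 1$ let $G_n$ be a nilpotent group of class (exactly) $n$, and let $\delta_{G_n}$ and $\iota_{G_n}$ be the discrete and the indiscrete topology on $G_n$. Then the continuous isomorphism $\prod_{n=1}^\infty id_{G_n}:\prod_{n=1}^\infty(G_n,\delta_{G_n})\to\prod_{n=1}^\infty(G_n,\iota_{G_n})$ (products carrying the product topologies) is not $m$-step semitopological for any integer $m\ge 1$; that is, it is not a composition of finitely many semitopological isomorphisms.
   Context: Group topologies are not assumed Hausdorff. A continuous group isomorphism $f:(G,\tau)\to(H,\sigma)$ of topological groups is semitopological if there exist a topological group $(\widetilde G,\widetilde\tau)$ containing $G$ as a normal subgroup with $\widetilde\tau$ inducing $\tau$ on $G$, and an open continuous homomorphism $\widetilde f:(\widetilde G,\widetilde\tau)\to(H,\sigma)$ extending $f$. For group topologies $\sigma\le\tau$ on a group $G$ and $m\ge1$, $id_G:(G,\tau)\to(G,\sigma)$ is $m$-step semitopological if there exist group topologies $\sigma\le\lambda_{m-1}\le\dots\le\lambda_1\le\tau$ on $G$ such that, with $\lambda_0=\tau$ and $\lambda_m=\sigma$, each $id_G:(G,\lambda_{i-1})\to(G,\lambda_i)$, $1\le i\le m$, is semitopological. *)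

(* Defs.v *)
From HB Require Import structures.
From mathcomp Require Import all_boot.
From mathcomp Require Import all_classical.
From mathcomp Require Import topology.

Set Implicit Arguments.
Unset Strict Implicit.
Unset Printing Implicit Defensive.

Local Open Scope classical_set_scope.
Local Open Scope group_scope.

(** Several topologies on the same carrier are compared below, so a topology
    is a first-class value, given by its open sets; [tspace tau] is the carrier
    seen as a [topologicalType] through [tau]. *)
Record topology (T : Type) := Topology {
  topen :> set_system T;
  topenT : topen setT;
  topenI : setI_closed topen;
  topen_bigcup : forall (I : Type) (f : I -> set T),
    (forall i, topen (f i)) -> topen (\bigcup_i f i)
}.

Definition tspace (T : Type) (tau : topology T) : Type := T.

HB.instance Definition _ (T : choiceType) (tau : topology T) :=
  Choice.on (tspace tau).
HB.instance Definition _ (T : choiceType) (tau : topology T) :=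
  isOpenTopological.Build (tspace tau)
    (topenT tau) (@topenI T tau) (@topen_bigcup T tau).

Lemma open_tspaceE (T : choiceType) (tau : topology T) :
  @open (tspace tau) = topen tau.
Proof. by []. Qed.

(** No separation axiom is required. *)
Record group_topology (G : groupType) := GroupTopology {
  gtop :> topology G;
  gtop_mul_continuous :
    continuous ((fun x => x.1 * x.2) : tspace gtop * tspace gtop -> tspace gtop);
  gtop_inv_continuous :
    continuous ((fun x => x^-1) : tspace gtop -> tspace gtop)
}.

Definition coarser (G : groupType) (sigma tau : group_topology G) : Prop :=
  topen sigma `<=` topen tau.

Section DiscreteIndiscrete.
Variable G : groupType.

Definition discrete_top : topology G :=
  @Topology G setT I (fun _ _ _ _ => I) (fun _ _ _ => I).

Lemma discrete_mul_continuous : continuous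
  ((fun x => x.1 * x.2)
   : tspace discrete_top * tspace discrete_top -> tspace discrete_top).
Proof.
move=> [a b] A /nbhs_singleton Aab.
exists ([set a], [set b]); first by split; apply: open_nbhs_nbhs; split.
by move=> [x y] [/= -> ->].
Qed.

Lemma discrete_inv_continuous : continuous
  ((fun x => x^-1) : tspace discrete_top -> tspace discrete_top).
Proof. by apply/continuousP. Qed.

Definition discrete_gtop : group_topology G :=
  GroupTopology discrete_mul_continuous discrete_inv_continuous.

Definition indiscrete_open : set_system G :=
  [set U | U = set0 \/ U = setT].

Lemma indiscrete_openT : indiscrete_open setT.
Proof. by right. Qed.

Lemma indiscrete_openI : setI_closed indiscrete_open.
Proof.
by move=> A B [->|->] [->|->]; rewrite ?set0I ?setTI; [left|left|left|right].
Qed.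

Lemma indiscrete_open_bigcup (I : Type) (f : I -> set G) :
  (forall i, indiscrete_open (f i)) -> indiscrete_open (\bigcup_i f i).
Proof.
move=> f0T; have [[i fi]|noT] := pselect (exists i, f i = setT).
  by right; apply/seteqP; split=> // x _; exists i; rewrite // fi.
left; apply/seteqP; split=> // x [i _].
by case: (f0T i) => fi; [rewrite fi|case: noT; exists i].
Qed.

Definition indiscrete_top : topology G :=
  Topology indiscrete_openT indiscrete_openI indiscrete_open_bigcup.

Lemma indiscrete_continuous (T : topologicalType)
  (f : T -> tspace indiscrete_top) : continuous f.
Proof.
by apply/continuousP => A [->|->];
  rewrite ?preimage_set0 ?preimage_setT; [exact: open0|exact: openT].
Qed.

Definition indiscrete_gtop : group_topology G :=
  @GroupTopology G indiscrete_top
    (@indiscrete_continuous _ _) (@indiscrete_continuous _ _).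

End DiscreteIndiscrete.

Section ProductGroup.
Variables (I : Type) (G : I -> groupType).

Definition prod_group : Type := forall i, G i.

HB.instance Definition _ := Choice.copy prod_group (forall i, G i).

Definition prod_mulg (x y : prod_group) : prod_group := fun i => x i * y i.
Definition prod_one : prod_group := fun=> 1.
Definition prod_invg (x : prod_group) : prod_group := fun i => (x i)^-1.

Lemma prod_mulgA : associative prod_mulg.
Proof. by move=> x y z; apply/functional_extensionality_dep => i; exact: mulgA. Qed.
Lemma prod_mul1g : left_id prod_one prod_mulg.
Proof. by move=> x; apply/functional_extensionality_dep => i; exact: mul1g. Qed.
Lemma prod_mulg1 : right_id prod_one prod_mulg.
Proof. by move=> x; apply/functional_extensionality_dep => i; exact: mulg1. Qed.
Lemma prod_mulVg : left_inverse prod_one prod_invg prod_mulg.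
Proof. by move=> x; apply/functional_extensionality_dep => i; exact: mulVg. Qed.
Lemma prod_mulgV : right_inverse prod_one prod_invg prod_mulg.
Proof. by move=> x; apply/functional_extensionality_dep => i; exact: mulgV. Qed.

HB.instance Definition _ :=
  isGroup.Build prod_group prod_mulgA prod_mul1g prod_mulg1 prod_mulVg prod_mulgV.

Variable tau : forall i, group_topology (G i).

Local Notation PT := (prod_topology (fun i => tspace (tau i))).

Definition prod_top : topology prod_group :=
  @Topology prod_group (@open PT) (@openT PT) (@openI PT)
    (fun J f fo => @bigcup_open PT J setT f (fun j _ => fo j)).

Lemma continuous_to_prod (T : topologicalType) (f : T -> tspace prod_top) :
  (forall i, continuous ((fun x => f x i) : T -> tspace (tau i))) ->
  continuous f.
Proof.
move=> fc x.
suff : (f : T -> PT) @ x --> (f x : PT).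
  move=> fx U /= [B [Bo Bfx BU]]; apply: fx.
  by apply: filterS BU _; apply: open_nbhs_nbhs; split.
apply/cvg_sup => i U [B [[C Co <-] Cfx BU]].
apply: filterS BU _.
by apply: (fc i x); apply: open_nbhs_nbhs; split.
Qed.

Lemma continuous_from_prod i :
  continuous ((fun x => x i) : tspace prod_top -> tspace (tau i)).
Proof.
move=> x; have /cvg_sup/(_ i) xi : nbhs (x : PT) --> (x : PT) by [].
apply: cvg_trans (@initial_continuous _ _ (fun y : PT => y i) x).
exact: (cvg_app _ xi).
Qed.

Lemma prod_mul_continuous : continuous
  ((fun x => x.1 * x.2)
   : tspace prod_top * tspace prod_top -> tspace prod_top).
Proof.
apply: continuous_to_prod => i z.
pose g (w : tspace prod_top * tspace prod_top) :
  tspace (tau i) * tspace (tau i) := (w.1 i, w.2 i).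
have gc : continuous g.
  move=> w A [[B C] /= [Bw Cw] BCA].
  exists ((fun x => x i) @^-1` B, (fun x => x i) @^-1` C) => /=.
    by split; exact: continuous_from_prod.
  by move=> x [Bx Cx]; apply: BCA.
exact: (continuous_comp (gc z) (@gtop_mul_continuous _ (tau i) (g z))).
Qed.

Lemma prod_inv_continuous : continuous
  ((fun x => x^-1) : tspace prod_top -> tspace prod_top).
Proof.
apply: continuous_to_prod => i x.
exact: (continuous_comp (@continuous_from_prod i x)
          (@gtop_inv_continuous _ (tau i) (x i))).
Qed.

Definition prod_gtop : group_topology prod_group :=
  GroupTopology prod_mul_continuous prod_inv_continuous.

End ProductGroup.

(** Overgroups are given up to isomorphism, by an embedding [j] whose range is a
    normal subgroup and through which [tau] is the induced topology. *)
Definition semitopological (G H : groupType) (tau : group_topology G)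
    (sigma : group_topology H) (f : G -> H) : Prop :=
  [/\ {morph f : x y / x * y}, bijective f,
      continuous (f : tspace tau -> tspace sigma) &
      exists (Gt : groupType) (taut : group_topology Gt)
             (j : G -> Gt) (ft : Gt -> H),
        [/\ [/\ {morph j : x y / x * y}, injective j,
                (forall x g, range j x -> range j (x ^ g)) &
                @open (tspace tau)
                  = @open (initial_topology (j : tspace tau -> tspace taut))],
            {morph ft : x y / x * y},
            continuous (ft : tspace taut -> tspace sigma),
            (forall U : set (tspace taut),
               open U -> open (ft @` U : set (tspace sigma))) &
            forall x, ft (j x) = f x]].

Definition step_semitopological (G : groupType) (tau sigma : group_topology G)
    (m : nat) : Prop :=
  exists lambda : nat -> group_topology G,
    [/\ lambda 0%N = tau, lambda m = sigma,
        (forall i, (i < m)%N -> coarser (lambda i.+1) (lambda i)) &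
        forall i, (i < m)%N ->
          semitopological (lambda i) (lambda i.+1) (@id G)].

Section NilpotencyClass.
Variable G : groupType.

Definition generated_subgroup (A : set G) : set G :=
  smallest [set H : set G | group_closed [in H]] A.

(** [lower_central k] is the term usually written gamma_(k+1)(G). *)
Fixpoint lower_central (k : nat) : set G :=
  if k is k'.+1 then
    generated_subgroup
      [set z | exists2 x, lower_central k' x & exists y : G, z = [~ x, y]]
  else setT.

Definition nilpotent_of_class (c : nat) : Prop :=
  lower_central c = [set 1] /\
  forall k, (k < c)%N -> lower_central k <> [set 1].

End NilpotencyClass.

(* Main.v *)
Require Import Defs.
From mathcomp Require Import all_boot all_classical topology.

(** If [id : (G, tau) -> (G, sigma)] is semitopological, then for every [g] and
    every [tau]-neighbourhood [U] of 1 there is a [sigma]-neighbourhood [V] of 1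
    with [[V, g] <= U].  Along a chain of [m] such steps that ends in the
    indiscrete topology, every [m]-fold commutator [[x, g_1, .., g_m]] thus lies
    in every neighbourhood of 1 of the first topology.  In the product of the
    discrete [G n] the kernel of a coordinate projection is such a neighbourhood,
    so each factor would be nilpotent of class at most [m]. *)

Set Implicit Arguments.
Unset Strict Implicit.
Unset Printing Implicit Defensive.

Local Open Scope classical_set_scope.
Local Open Scope group_scope.

Section UpperCentral.
Variable G : groupType.
Implicit Types (x y z : G) (A : set G).

(** The upper central series, given by commutator conditions on elements; that its terms are
    subgroups is proved separately. *)
Fixpoint upper_central (k : nat) : set G :=
  if k is k'.+1 then [set x | forall y, upper_central k' [~ x, y]] else [set 1].

Lemma upper_centralJ k x y : upper_central k x -> upper_central k (x ^ y).
Proof.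
elim: k x y => [|k IHk] x y /=; first by move=> ->; rewrite conj1g.
move=> Zx z; have -> : [~ x ^ y, z] = [~ x, z ^ y^-1] ^ y.
  by rewrite conjRg -conjgM mulVg conjg1.
exact: IHk.
Qed.

(** Induction on [k] through [xy, z] = [x, z]^y [y, z] and [x^-1, z] = ([x, z]^-1)^(x^-1), each term
    being stable under conjugation. *)
Lemma upper_central_group k : group_closed [in upper_central k].
Proof.
suff [Z1 ZM ZV] : [/\ upper_central k 1,
    forall x y, upper_central k x -> upper_central k y ->
      upper_central k (x * y) &
    forall x, upper_central k x -> upper_central k x^-1].
  by split=> [|x y]; rewrite !inE // => Zx Zy; apply: ZM => //; exact: ZV.
elim: k => [|k [Z1 ZM ZV]] /=.
  by split=> [//|x y -> ->|x ->]; rewrite ?mulg1 ?invg1.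
split=> [y|x y Zx Zy z|x Zx z]; first by rewrite comm1g.
  have -> : [~ x * y, z] = [~ x, z] ^ y * [~ y, z].
    by rewrite !commgEr conjgM [in RHS]conjMg -[RHS]mulgA [_^-1 ^ y]conjVg mulVKg.
  by apply: ZM; [exact: upper_centralJ|].
have -> : [~ x^-1, z] = [~ x, z]^-1 ^ x^-1.
  by rewrite !commgEr invgM -conjVg invgK [in RHS]conjMg conjgK.
exact/upper_centralJ/ZV.
Qed.

Lemma generated_subgroup_sub A (H : set G) :
  group_closed [in H] -> A `<=` H -> generated_subgroup A `<=` H.
Proof. by move=> gH AH x; apply. Qed.

(** Commutators of elements of one upper central term lie in the term below, which is a subgroup and
    so contains what they generate. *)
Lemma lower_central_sub_upper c k : (k <= c)%N ->
  upper_central c = setT -> @lower_central G k `<=` upper_central (c - k).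
Proof.
move=> + ZT; elim: k => [|k IHk] lkc; first by rewrite subn0 ZT.
apply: generated_subgroup_sub; first exact: upper_central_group.
move=> _ [x gx [y ->]]; have := IHk (ltnW lkc) x gx.
by rewrite -(subnSK lkc); apply.
Qed.

Lemma upper_central_foldl k x :
  (forall s : seq G, size s = k -> foldl (fun u g => [~ u, g]) x s = 1) ->
  upper_central k x.
Proof.
elim: k x => [|k IHk] x xs; first exact: (xs [::]).
by move=> y; apply: IHk => s ss; apply: (xs (y :: s)); rewrite /= ss.
Qed.

End UpperCentral.

Lemma commg_continuous (G : groupType) (tau : group_topology G) (g : G) :
  continuous ((fun x => [~ x, g]) : tspace tau -> tspace tau).
Proof.
have mulc (f h : tspace tau -> tspace tau) : continuous f -> continuous h ->
    continuous ((fun x => (f x : G) * h x) : tspace tau -> tspace tau).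
  move=> fc hc x.
  pose p (x : tspace tau) : tspace tau * tspace tau := (f x, h x).
  have pc : continuous p by move=> y; exact: cvg_pair (fc y) (hc y).
  exact: (continuous_comp (pc x) (@gtop_mul_continuous _ tau (p x))).
apply: (mulc _ _); first exact: gtop_inv_continuous.
apply: (mulc (fun=> g^-1)); first exact: cst_continuous.
by apply: (mulc id (fun=> g)) => x; [exact: cvg_id|exact: cst_continuous].
Qed.

(** [V] is the image under the open map [ft] of the set [W] of all w in the overgroup with [w, j g]
    in [O], where [O] is open and induces [U]. *)
Lemma semitopological_commg (G : groupType) (tau sigma : group_topology G)
    (g : G) (U : set G) :
  semitopological tau sigma id -> topen tau U -> U 1 ->
  exists V, [/\ topen sigma V, V 1 & forall v, V v -> U [~ v, g]].
Proof.
move=> [_ _ _ [Gt [taut [j [ft [[jM jI jN jO] ftM _ fto ftj]]]]]].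
rewrite -open_tspaceE jO => -[O Oo <-] O1.
have j1 : j 1 = 1 by apply: (mulgI (j 1)); rewrite -jM !mulg1.
have ft1 : ft 1 = 1 by rewrite -j1 ftj.
have homR (G1 G2 : groupType) (f : G1 -> G2) : {morph f : x y / x * y} ->
    {morph f : x y / [~ x, y]}.
  move=> fM; have f1 : f 1 = 1 by apply: (mulgI (f 1)); rewrite -fM !mulg1.
  have fV x : f x^-1 = (f x)^-1 by apply: (mulgI (f x)); rewrite -fM !mulgV.
  by move=> x y; rewrite /commg /conjg !fM !fV.
pose W : set (tspace taut) := (fun w : Gt => [~ w, j g]) @^-1` O.
exists (ft @` W); split.
- by apply: fto; move/continuousP: (@commg_continuous _ taut (j g)); apply.
- by exists 1; rewrite //= /W /= comm1g -j1.
move=> _ [w Ww <-] /=.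
(* By normality [[w, j g]] lies in the range of [j], and there [ft] inverts [j]. *)
have [y _ jy] : range j [~ w, j g].
  rewrite commgEr.
  have [|z _ <-] := jN (j g)^-1 w; last by exists (z * g); rewrite ?jM.
  by exists g^-1; last by apply: (mulgI (j g)); rewrite -jM !mulgV.
have <- : y = [~ ft w, g] by rewrite -(ftj y) jy homR // ftj.
by rewrite /= jy.
Qed.

Lemma step_semitopological_commg (G : groupType) (tau sigma : group_topology G)
    (s : seq G) (U : set G) :
  step_semitopological tau sigma (size s) -> topen tau U -> U 1 ->
  exists V, [/\ topen sigma V, V 1 &
    forall v, V v -> U (foldl (fun u g => [~ u, g]) v s)].
Proof.
move=> [lambda [<- <- _ lstep]] Uo U1.
elim: s lstep => [|g s IHs] lstep; first by exists U.
have [|V' [V'o V'1 V'U]] := IHs.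
  by move=> i si; apply: lstep; rewrite (ltn_trans si) /=.
(* [foldl] applies the head [g] first, so [g] goes with the last step of the chain and the tail [s]
   with the chain cut before it. *)
have [V [Vo V1 VV']] := semitopological_commg g (lstep _ (ltnSn _)) V'o V'1.
by exists V; split=> // v /VV' /V'U.
Qed.

(** Continuity into a product is checked on coordinates, so the identity from the indiscrete
    topology to the product one is continuous. *)
Lemma prod_indiscrete_open (I : Type) (G : I -> groupType)
    (V : set (prod_group G)) :
  topen (prod_gtop (fun i => indiscrete_gtop (G i))) V -> V 1 -> V = setT.
Proof.
move=> Vo V1.
have /continuousP/(_ V Vo) : continuous
    (id : tspace (indiscrete_top (prod_group G)) ->
          tspace (prod_top (fun i => indiscrete_gtop (G i)))).
  by apply: continuous_to_prod => i; exact: indiscrete_continuous.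
by case=> // V0; have : set0 (1 : prod_group G) by rewrite -V0.
Qed.

Lemma prod_group_commg (I : Type) (G : I -> groupType) (x y : prod_group G) i :
  [~ x, y] i = [~ x i, y i].
Proof. by []. Qed.

Theorem mainTheorem8 (G : nat -> groupType)
    (hG : forall n : nat, nilpotent_of_class (G n) n.+1)
    (m : nat) (hm : (1 <= m)%N) :
  ~ step_semitopological
      (prod_gtop (fun n => discrete_gtop (G n)))
      (prod_gtop (fun n => indiscrete_gtop (G n)))
      m.
Proof.
move=> hstep.
(* [G m] has class [m.+1], so its upper central series cannot reach the whole group at [m]. *)
have ZT : @upper_central (G m) m = setT.
  apply/seteqP; split=> // x _; apply: upper_central_foldl => s sm.
  pose lift (y : G m) : prod_group G := dfwith (fun=> 1) m y.
  have liftE y : lift y m = y by rewrite /lift dfwithin.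
  pose U : set (prod_group G) := (fun y => y m) @^-1` [set 1].
  have Uo : topen (prod_gtop (fun n => discrete_gtop (G n))) U.
    have /continuousP/(_ [set 1]) :=
      @continuous_from_prod _ _ (fun n => discrete_gtop (G n)) m.
    by apply.
  rewrite -sm -(size_map lift) in hstep.
  have [V [Vo V1 VU]] := step_semitopological_commg hstep Uo (erefl : U 1).
  have /VU : V (lift x) by rewrite (prod_indiscrete_open Vo V1).
  (* Coordinate [m] of the iterated commutator of the lifts is the iterated commutator in [G m]. *)
  rewrite /U /= => <-; rewrite -[in LHS](liftE x).
  elim: s (lift x) {hstep sm VU} => [|g s IHs] y //=.
  by rewrite -IHs prod_group_commg liftE.
have [_ /(_ m (ltnSn m))] := hG m; apply; apply/seteqP; split.
  by have := lower_central_sub_upper (leqnn m) ZT; rewrite subnn.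
move=> _ ->; case: (m) => // k A [[A1 _] _].
by move: A1; rewrite inE.
Qed.
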